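(* Consider the repair MDP and the index policy $\theta^{\mathrm{IND}}$ described in the context. Suppose the following three conditions are satisfied: (i) All machines are directly connected to each other; that is, the network is a complete graph. (ii) Each machine has only two possible states; that is, $K_j=1$ for each $j\in M$. (iii) The degradation rates, repair rates and cost functions are the same for all machines; that is, $\lambda_1=\dots=\lambda_m$, $\mu_1=\dots=\mu_m$ and $f_1(1)=\dots=f_m(1)$. Then the index policy is optimal, i.e. $g_{\theta^{\mathrm{IND}}}(\mathbf{x})\le g_\theta(\mathbf{x})$ for all $\theta\in\Theta$ and $\mathbf{x}\in S$.
   Context: Repair MDP. Let $G=(V,E)$ be a finite connected graph (the network), $M\subseteq V$ a set of $m\ge 2$ nodes called machines (labelled $1,\dots,m$), and $N=V\setminus M$ the set of intermediate stages. For each machine $j\in M$ there are an integer $K_j\ge 1$, a degradation rate $\lambda_j>0$, a repair rate $\mu_j>0$, and a strictly increasing cost function $f_j:\{0,1,\dots,K_j\}\to\mathbb{R}$ with $f_j(0)=0$. There is a switching rate $\tau>0$. Units of time are scaled so that $\sum_{j\in M}\lambda_j+\max\{\mu_1,\dots,\mu_m,\tau\}=1$ (so rates serve as one-step transition probabilities of the uniformized discrete-time MDP). The state space is $S=\{(i,(x_1,\dots,x_m)) : i\in V,\ x_j\in\{0,1,\dots,K_j\}\text{ for }j\in M\}$, where $i$ is the node occupied by the single repairer and $x_j$ is the condition of machine $j$. For $\mathbf{x}=(i,(x_1,\dots,x_m))$, let $R(\mathbf{x})$ be the set of nodes adjacent to $i$ and let $A_{\mathbf{x}}=\{i\}\cup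 R(\mathbf{x})$ be the set of actions (action $i$ means remain; action $a\in R(\mathbf{x})$ means attempt to move to $a$). For distinct states $\mathbf{x}=(i,(x_1,\dots,x_m))$, $\mathbf{x}'=(i',(x_1',\dots,x_m'))$ in $S$ and $a\in A_{\mathbf{x}}$, the transition probability $p_{\mathbf{x},\mathbf{x}'}(a)$ equals: $\lambda_j$ if $i'=i$, $x_j'=x_j+1$ for some $j\in M$ and $x_l'=x_l$ for $l\ne j$; $\mu_i$ if $i\in M$, $i'=i$, $x_i'=x_i-1$, $x_j'=x_j$ for $j\neq i$, and $a=i$; $\tau$ if $i'\in R(\mathbf{x})$, $x_j'=x_j$ for all $j\in M$, and $a=i'$; and $0$ otherwise. Also $p_{\mathbf{x},\mathbf{x}}(a)=1-\sum_{\mathbf{y}\ne\mathbf{x}}p_{\mathbf{x},\mathbf{y}}(a)$. The one-step cost is $c(\mathbf{x})=\sum_{j\in M}f_j(x_j)$; $\Theta$ is the set of all admissible policies (rules for choosing, at each time step, an action available in the current state); and $g_\theta(\mathbf{x})=\liminf_{t\to\infty}t^{-1}\mathbb{E}_\theta\big[\sum_{n=0}^{t-1}c(\mathbf{x}_n)\mid\mathbf{x}_0=\mathbf{x}\big]$. Quantities for the index policy. For $j\in M$ and $k\in\{1,\dots,K_j\}$, let $s_j(k)=\mu_j[f_j(K_j)-f_j(k-1)]/\lambda_j$. Suppose machine $j$ is under uninterrupted repair starting in state $k$, so that its state is a continuous-time Markov chain on $\{0,\dots,K_j\}$ with rate $\lambda_j$ from $l$ to $l+1$ (for $l\le K_j-1$)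 and rate $\mu_j$ from $l$ to $l-1$ (for $l\geq 1$). $T_j(k)$ is the time until it first reaches state $0$, and $R_j(k)$ is the reward accumulated until that time when reward accrues at rate $s_j(l)$ in state $l$; $T_j(0)=R_j(0)=0$. Let $d_{ij}$ be the graph distance from $i\in V$ to $j\in V$ and let $D_{ij}$ be the time to travel from $i$ to $j$ along a shortest path, with $\mathbb{E}[D_{ij}]=d_{ij}/\tau$. For $j\in M$, $j\ne i$, and current machine state $x_j$, $X_j$ denotes the (random) state of machine $j$ when the repairer arrives there after setting off immediately from $i$: $$\mathbb{P}(X_j=k)=\binom{d_{ij}+k-x_j-1}{d_{ij}-1}\Big(\frac{\tau}{\lambda_j+\tau}\Big)^{d_{ij}}\Big(\frac{\lambda_j}{\lambda_j+\tau}\Big)^{k-x_j}\ (x_j\le k\le K_j-1),\quad \mathbb{P}(X_j=K_j)=1-\sum_{r=x_j}^{K_j-1}\mathbb{P}(X_j=r),$$ and $\mathbb{E}[D_{ij}|X_j=k]=\frac{d_{ij}+k-x_j}{\tau+\lambda_j}$ for $x_j\le k\le K_j-1$, while $\mathbb{E}[D_{ij}|X_j=K_j]=\frac{d_{ij}/\tau-\sum_{k=x_j}^{K_j-1}\mathbb{P}(X_j=k)\mathbb{E}[D_{ij}|X_j=k]}{1-\sum_{k=x_j}^{K_j-1}\mathbb{P}(X_j=k)}$. Indices: for $i\in M$, $\Phi_i^{\mathrm{stay}}(x_i)=\mathbb{E}[R_i(x_i)]/\mathbb{E}[T_i(x_i)]$ if $x_i\ge1$, and $\Phi_i^{\mathrm{stay}}(0)=0$.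 For $i\in V$, $j\in M\setminus\{i\}$, $$\Phi_{ij}^{\mathrm{move}}(x_j)=\sum_{k=x_j}^{K_j}\mathbb{P}(X_j=k)\frac{\mathbb{E}[R_j(k)]}{\mathbb{E}[D_{ij}|X_j=k]+\mathbb{E}[T_j(k)]},$$ $$\Phi_{ij}^{\mathrm{wait}}(x_j)=\sum_{k=x_j}^{K_j-1}\mathbb{P}(X_j=k)\frac{\mathbb{E}[R_j(k+1)]}{1/\lambda_j+\mathbb{E}[D_{ij}|X_j=k]+\mathbb{E}[T_j(k+1)]}+\mathbb{P}(X_j=K_j)\frac{\mathbb{E}[R_j(K_j)]}{1/\lambda_j+\mathbb{E}[D_{ij}|X_j=K_j]+\mathbb{E}[T_j(K_j)]}.$$ Let $\Psi(i)=\sum_{j\in M}\frac{\lambda_j}{\lambda_1+\dots+\lambda_m}\mathbb{E}[D_{ij}]$ for $i\in V$. Index policy $\theta^{\mathrm{IND}}$: the stationary policy which in state $\mathbf{x}=(i,(x_1,\dots,x_m))$ acts as follows. 1. If $x_j=0$ for all $j\in M$: let $i^*\in\arg\min_{i'\in V}\Psi(i')$; move to the first node on the shortest path from $i$ to $i^*$ if $i\ne i^*$, or remain at $i^*$ if $i=i^*$. 2. If $x_j\ge1$ for at least one $j\in M$: (a) If $i\in M$: let $J=\{j\in M\setminus\{i\}:\Phi_{ij}^{\mathrm{move}}(x_j)\ge\Phi_{ij}^{\mathrm{wait}}(x_j)\}$. If $J\ne\emptyset$, let $j^*\in J$ maximize $\Phi_{ij}^{\mathrm{move}}(x_j)$ over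 $J$; if $\Phi_{ij^*}^{\mathrm{move}}(x_{j^*})>\Phi_i^{\mathrm{stay}}(x_i)$ move to the first node on the shortest path from $i$ to $j^*$. If $J=\emptyset$ or $\Phi_{ij^*}^{\mathrm{move}}(x_{j^*})\le\Phi_i^{\mathrm{stay}}(x_i)$, remain at $i$. (b) If $i\in N$: let $j^*$ be the machine maximizing $\Phi_{ij}^{\mathrm{move}}(x_j)$ over $j\in M$; move to the first node on the shortest path from $i$ to $j^*$. Where two or more actions are viable under these rules, the choice is made by a pre-determined priority ordering of the nodes in $V$. *)

(* Defs.v *)
From HB Require Import structures.
From mathcomp Require Import all_boot all_order all_algebra.
From mathcomp Require Import all_classical all_reals all_analysis.

Set Implicit Arguments.
Unset Strict Implicit.
Unset Printing Implicit Defensive.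

Import Order.TTheory GRing.Theory Num.Theory.
Import numFieldNormedType.Exports.

Local Open Scope classical_set_scope.
Local Open Scope ring_scope.

Section Graph.
Variables (V : finType) (e : rel V).

(* The least n < #|V| such that some path with n edges joins u to v
   (and #|V| if there is none). *)
Definition dist (u v : V) : nat :=
  find (fun n => [exists p : n.-tuple V, path e u p && (last u p == v)])
       (iota 0 #|V|).

(* First nodes on the shortest paths from u to v; this is [set u] if u = v. *)
Definition first_nodes (u v : V) : {set V} :=
  [set a | [exists p : (dist u v).-tuple V,
              [&& path e u p, last u p == v & a == head u p]]].

End Graph.

(* The machines are labelled by 'I_nmach, and machine j sits at node [loc j], so
   that M is the image of [loc].  Only the values of [fcost j] on 0, ..., kmax j
   are meaningful. *)
Record repair_mdp (R : realType) := RepairMDP {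
  node : finType;
  adj : rel node;
  nmach : nat;
  loc : 'I_nmach -> node;
  kmax : 'I_nmach -> nat;
  lam : 'I_nmach -> R;
  mu : 'I_nmach -> R;
  tau : R;
  fcost : 'I_nmach -> nat -> R;
  adj_sym : symmetric adj;
  adj_irr : irreflexive adj;
  adj_connected : forall u v, connect adj u v;
  nmach_ge2 : (2 <= nmach)%N;
  loc_inj : injective loc;
  kmax_ge1 : forall j, (1 <= kmax j)%N;
  lam_gt0 : forall j, 0 < lam j;
  mu_gt0 : forall j, 0 < mu j;
  tau_gt0 : 0 < tau;
  fcost0 : forall j, fcost j 0%N = 0;
  fcost_incr : forall j k l, (k < l <= kmax j)%N -> fcost j k < fcost j l;
  uniformized : \sum_j lam j + \big[Num.max/tau]_j mu j = 1
}.

Section MDP.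
Variables (R : realType) (G : repair_mdp R).

Local Notation V := (node G).
Local Notation machine := 'I_(nmach G).
Local Notation K := (@kmax R G).
Local Notation lam := (@lam R G).
Local Notation mu := (@mu R G).
Local Notation tau := (tau G).
Local Notation f := (@fcost R G).

Definition state := (V * {dffun forall j : machine, 'I_(K j).+1})%type.

Definition actions (x : state) : {set V} := [set a | (a == x.1) || adj x.1 a].

Definition agree_off (j : machine) (x y : state) : bool :=
  [forall l, (l != j) ==> (y.2 l == x.2 l)].

Definition degradation (x y : state) (j : machine) : bool :=
  [&& y.1 == x.1, y.2 j == (x.2 j).+1 :> nat & agree_off j x y].

Definition repair (a : V) (x y : state) (j : machine) : bool :=
  [&& loc j == x.1, y.1 == x.1, x.2 j == (y.2 j).+1 :> nat,
      agree_off j x y & a == x.1].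

Definition switch (a : V) (x y : state) : bool :=
  [&& adj x.1 y.1, y.2 == x.2 & a == y.1].

Definition rate_to (a : V) (x y : state) : R :=
  if [pick j | degradation x y j] is Some j then lam j
  else if [pick j | repair a x y j] is Some j then mu j
  else if switch a x y then tau
  else 0.

Definition trans (a : V) (x y : state) : R :=
  if y == x then 1 - \sum_(z | z != x) rate_to a x z else rate_to a x y.

Definition cost (x : state) : R := \sum_j f j (x.2 j).

(* History-dependent randomized policies: [pol h x a] is the probability of
   choosing a in the current state x after the past state-action pairs h,
   listed in chronological order. *)
Record policy := Policy {
  pol :> seq (state * V) -> state -> V -> R;
  pol_ge0 : forall h x a, 0 <= pol h x a;
  pol_sum1 : forall h x, \sum_a pol h x a = 1;
  pol_actions : forall h x a, a \notin actions x -> pol h x a = 0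
}.

(* Probability of following w = (a_0, x_1), (a_1, x_2), ... from the current
   state x, given the past h. *)
Fixpoint traj_prob (theta : policy) (h : seq (state * V)) (x : state)
    (w : seq (V * state)) : R :=
  if w is (a, y) :: w' then
    theta h x a * trans a x y * traj_prob theta (rcons h (x, a)) y w'
  else 1.

(* [belast x (unzip2 w)] is x_0, ..., x_{t-1}. *)
Definition expected_cost (theta : policy) (x : state) (t : nat) : R :=
  \sum_(w : t.-tuple (V * state)%type)
    traj_prob theta [::] x w * \sum_(z <- belast x (unzip2 w)) cost z.

Definition avg_cost (theta : policy) (x : state) : \bar R :=
  limn_einf (fun t : nat => ((t%:R)^-1 * expected_cost theta x t)%:E).

Section Stationary.
Variables (d : state -> V) (dA : forall x, d x \in actions x).

Definition stationary_prob (h : seq (state * V)) (x : state) (a : V) : R :=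
  (a == d x)%:R.

Lemma stationary_ge0 h x a : 0 <= stationary_prob h x a.
Proof. exact: ler0n. Qed.

Lemma stationary_sum1 h x : \sum_a stationary_prob h x a = 1.
Proof.
rewrite /stationary_prob (bigD1 (d x)) //= eqxx big1 ?addr0 // => a.
by move/negbTE ->.
Qed.

Lemma stationary_actions h x a :
  a \notin actions x -> stationary_prob h x a = 0.
Proof.
rewrite /stationary_prob; case: eqP => // ->.
by rewrite dA.
Qed.

Definition stationary : policy :=
  Policy stationary_ge0 stationary_sum1 stationary_actions.
End Stationary.

Section CTMC.
Context {d : measure_display} {Omega : measurableType d}.
Variable P : probability Omega R.
Context {S : finType}.

Definition exit_rate (q : S -> S -> R) (l : S) : R := \sum_l' q l l'.

(* X is a chain with transition rates q started at k, given by its jump chain Y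
   and holding times H: conditionally on Y the H n are independent exponential
   variables with rates [exit_rate q (Y n)], and Y is Markov with transition
   matrix q l l' / exit_rate q l.  This is meant for rates q vanishing on the
   diagonal and without absorbing states. *)
Definition is_ctmc (q : S -> S -> R) (k : S) (X : R -> Omega -> S) : Prop :=
  exists (Y : nat -> Omega -> S) (H : nat -> Omega -> R),
  [/\ forall n l, measurable [set w | Y n w = l],
      forall n, measurable_fun setT (H n),
      forall n (y : nat -> S) (t : nat -> R), (forall i, 0 <= t i) ->
        P [set w | forall i, (i <= n)%N -> Y i w = y i /\ t i < H i w] =
        ((y 0%N == k)%:R *
         (\prod_(i < n) (q (y i) (y i.+1) / exit_rate q (y i))) *
         \prod_(i < n.+1) expR (- (exit_rate q (y i) * t i)))%:E
    & forall n t w,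
        \sum_(i < n) H i w <= t < \sum_(i < n.+1) H i w -> X t w = Y n w].

Definition hitting_time (l : S) (X : R -> Omega -> S) (w : Omega) : \bar R :=
  ereal_inf [set t%:E | t in [set t : R | 0 <= t /\ X t w = l]].

Definition reward_until (l : S) (r : S -> R) (X : R -> Omega -> S) (w : Omega)
    : \bar R :=
  (\int[lebesgue_measure]_(t in [set t : R |
      (0 <= t)%R /\ t%:E < hitting_time l X w]) (r (X t w))%:E)%E.

End CTMC.

Definition srate (j : machine) (k : nat) : R :=
  mu j * (f j (K j) - f j k.-1) / lam j.

Definition repair_rate (j : machine) (l l' : 'I_(K j).+1) : R :=
  if l' == l.+1 :> nat then lam j else if l == l'.+1 :> nat then mu j else 0.

Section Indices.
Context {d : measure_display} {Omega : measurableType d}.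
Variable P : probability Omega R.
(* [X j k] is machine j under uninterrupted repair, started in state k. *)
Variable X : forall j : machine, nat -> R -> Omega -> 'I_(K j).+1.

Definition ET (j : machine) (k : nat) : R :=
  if k == 0%N then 0 else fine (\int[P]_w hitting_time ord0 (X j k) w)%E.

Definition ER (j : machine) (k : nat) : R :=
  if k == 0%N then 0 else
  fine (\int[P]_w reward_until ord0 (fun l => srate j l) (X j k) w)%E.

Definition dm (i : V) (j : machine) : nat := dist (@adj R G) i (loc j).

Definition ED (i : V) (j : machine) : R := (dm i j)%:R / tau.

(* [PX i j x k] is P(X_j = k), and [EDX i j x k] is E[D_ij | X_j = k], when the
   repairer sets off from i and machine j is in state x. *)
Definition PX_lt (i : V) (j : machine) (x k : nat) : R :=
  'C(dm i j + k - x - 1, dm i j - 1)%:R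
  * (tau / (lam j + tau)) ^+ dm i j * (lam j / (lam j + tau)) ^+ (k - x).

Definition PX (i : V) (j : machine) (x k : nat) : R :=
  if (k < K j)%N then PX_lt i j x k
  else 1 - \sum_(x <= r < K j) PX_lt i j x r.

Definition EDX_lt (i : V) (j : machine) (x k : nat) : R :=
  (dm i j + k - x)%:R / (tau + lam j).

Definition EDX (i : V) (j : machine) (x k : nat) : R :=
  if (k < K j)%N then EDX_lt i j x k
  else (ED i j - \sum_(x <= r < K j) PX_lt i j x r * EDX_lt i j x r)
       / (1 - \sum_(x <= r < K j) PX_lt i j x r).

Definition Phi_stay (j : machine) (x : nat) : R :=
  if x == 0%N then 0 else ER j x / ET j x.

Definition Phi_move (i : V) (j : machine) (x : nat) : R :=
  \sum_(x <= k < (K j).+1) PX i j x k * (ER j k / (EDX i j x k + ET j k)).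

Definition Phi_wait (i : V) (j : machine) (x : nat) : R :=
  (\sum_(x <= k < K j)
    PX i j x k * (ER j k.+1 / ((lam j)^-1 + EDX i j x k + ET j k.+1)))
  + PX i j x (K j)
    * (ER j (K j) / ((lam j)^-1 + EDX i j x (K j) + ET j (K j))).

Definition Psi (i : V) : R := \sum_j lam j / (\sum_l lam l) * ED i j.

(* If several actions comply with the rules, all of them are viable. *)
Definition viable (x : state) : {set V} :=
  let i := x.1 in
  let move j := Phi_move i j (x.2 j) in
  let wait j := Phi_wait i j (x.2 j) in
  let towards (B : {set machine}) :=
    (\bigcup_(j in B) first_nodes (@adj R G) i (loc j))%SET in
  if [forall j, x.2 j == 0%N :> nat] then
    (\bigcup_(v | [forall u, Psi v <= Psi u]) first_nodes (@adj R G) i v)%SET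
  else if [pick j | loc j == i] is Some j0 then
    let J := [set j | (j != j0) && (wait j <= move j)]%SET in
    let best := [set j in J | [forall l in J, move l <= move j]
                              && (Phi_stay j0 (x.2 j0) < move j)]%SET in
    if best == finset.set0 then [set i]%SET else towards best
  else towards [set j | [forall l, move l <= move j]]%SET.

(* [prio] lists the nodes by decreasing priority. *)
Definition index_action (prio : seq V) (x : state) : V :=
  head x.1 [seq a <- prio | a \in viable x].

Lemma first_nodes_actions (x : state) v :
  first_nodes (@adj R G) x.1 v \subset actions x.
Proof.
apply/fintype.subsetP => a; rewrite !inE.
case/existsP => -[[|b p] ?] /=; first by case/andP => _ ->.
by case/and3P => /andP[ab _] _ /eqP->; rewrite ab orbT.
Qed.

Lemma viable_actions x : viable x \subset actions x.
Proof.
rewrite /viable; case: ifP => _.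
  by apply/finset.bigcupsP => v _; apply: first_nodes_actions.
case: pickP => [j0|] _.
  case: ifP => _; first by rewrite finset.sub1set inE eqxx.
  by apply/finset.bigcupsP => j _; apply: first_nodes_actions.
by apply/finset.bigcupsP => j _; apply: first_nodes_actions.
Qed.

Lemma index_action_actions prio x : index_action prio x \in actions x.
Proof.
rewrite /index_action.
have := filter_all (mem (viable x)) prio.
case: [seq _ <- _ | _] => [_|a s /= /andP[av _]].
  by rewrite inE eqxx.
exact: (fintype.subsetP (viable_actions x)).
Qed.

Definition index_policy (prio : seq V) : policy :=
  stationary (index_action_actions prio).

End Indices.
End MDP.

(* Main.v *)
Require Import Defs.
From HB Require Import structures.
From mathcomp Require Import all_boot all_order all_algebra.
From mathcomp Require Import all_classical all_reals all_analysis.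
From mathcomp Require Import measurable_realfun ring lra.

Set Implicit Arguments.
Unset Strict Implicit.
Unset Printing Implicit Defensive.

Import Order.TTheory GRing.Theory Num.Theory.
Import numFieldNormedType.Exports.

Local Open Scope classical_set_scope.
Local Open Scope ring_scope.

(** The index policy minimizes the expected cost over every finite horizon t,
from every state; the comparison of long-run averages is then a comparison of
lower limits term by term ([le_avg_cost]).

When the machines are identical with two states each and the network is
complete, the indices are easy to compare.  Write s = f(1) / lam for the reward
of one repair, which takes the mean time 1 / mu.  Staying at a failed machine
has the index s * mu, moving to a failed machine s / (1/tau + 1/mu), and moving
to a working machine strictly less than that.  Hence the index policy stays at
a failed machine, otherwise heads for some failed machine, and heads for some
machine if none has failed ([index_action_stay], [index_action_travel],
[index_action_idle]).  The mean repair time comes from the hypothesis on the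
chains X ([integral_single_jump_hitting]).

By symmetry the expected cost of this policy over t steps depends only on the
number k of failed machines and on whether the repairer is at a failed machine,
at a working machine or at an intermediate stage.  Write F k, W k and S k for
these three costs ([class_value]).  The policy is optimal as soon as
<<
    W (k - 1) <= F k,   F k <= W k,   F k <= S k,   W k <= S k,
>>
for these say that a repair pays off, that with the same machines failed it is
best to be at a failed one, and that any machine is a better place than an
intermediate stage.  All four inequalities pass from t to t + 1 by a direct
computation ([class_value_ordered]): in each of them the difference of the two
sides at t + 1 is a combination of such differences at t with nonnegative
coefficients, because m lam + max mu tau <= 1.  So the costs solve the
finite-horizon optimality equations, and backward induction over
history-dependent policies concludes ([cost_to_go_ge],
[cost_to_go_stationary]). *)

(** * Integrals of nonnegative functions *)

(** The integral of a nonnegative function is a supremum over the simple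
functions below it, so it is monotone whether or not the functions are
measurable. This matters here because a hitting time is an infimum over
uncountably many times. *)
Lemma le_integral_nonneg d (T : measurableType d) (R : realType)
    (mu : {measure set T -> \bar R}) (f g : T -> \bar R) :
  (forall x, 0 <= f x)%E -> (forall x, f x <= g x)%E ->
  (\int[mu]_x f x <= \int[mu]_x g x)%E.
Proof.
move=> f0 fg.
have g0 x : (0 <= g x)%E by exact: le_trans (f0 x) (fg x).
rewrite !ge0_integralE// !patch_setT.
apply: ereal_sup_le => _ [h hf <-]; exists h => // x.
exact: le_trans (hf x) (fg x).
Qed.

(** The function f, measurable or not, lies between g and the function that
is g on E and +oo elsewhere, and these two measurable functions have the same
integral. *)
Lemma integral_eq_on_almost_sure d (T : measurableType d) (R : realType)
    (P : probability T R) (E : set T) (f g : T -> \bar R) :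
  measurable E -> P E = 1%E -> (forall x, 0 <= f x)%E ->
  (forall x, 0 <= g x)%E -> measurable_fun setT g ->
  (forall x, E x -> f x = g x) -> (forall x, ~ E x -> g x = 0%E) ->
  (\int[P]_x f x = \int[P]_x g x)%E.
Proof.
move=> mE PE f0 g0 mg fgE gE0.
have mCE : measurable (~` E) by exact: measurableC.
apply/eqP; rewrite eq_le; apply/andP; split; last first.
  apply: le_integral_nonneg => // x.
  by have [/fgE ->//|/gE0 ->] := pselect (E x).
(* All that is known of f off E is f <= +oo. *)
pose u x := if x \in E then g x else +oo%E.
have mu : measurable_fun setT u.
  apply: measurable_fun_if => //.
  - apply: (measurable_fun_bool true).
    by rewrite setTI preimage_mem_true.
  - exact: measurable_funTS.
have u0 x : (0 <= u x)%E by rewrite /u; case: ifP => // _; rewrite leey.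
apply: (@le_trans _ _ (\int[P]_x u x)%E).
  apply: le_integral_nonneg => // x; rewrite /u.
  case: ifPn => [/set_mem /fgE ->//|_]; exact: leey.
rewrite (ge0_ae_eq_integral (g := g))//.
have PCE : P (~` E) = 0%E by rewrite probability_setC// PE subee.
exists (~` E); split => //.
move=> x /= + Ex; apply => _; rewrite /u mem_set//.
Qed.

Lemma integral_expR_itvcy (R : realType) (r : R) : 0 < r ->
  (\int[lebesgue_measure]_(t in `[0%R, +oo[) (expR (- (r * t)))%:E =
   (r^-1)%:E)%E.
Proof.
move=> r0.
have mexp : measurable_fun (`[0%R, +oo[ : set R)
    (EFin \o (fun t : R => expR (- (r * t)))).
  apply/measurable_EFinP; apply: measurable_funTS.
  apply: measurableT_comp => //; apply: measurableT_comp => //.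
have I1 : (r%:E * \int[lebesgue_measure]_(t in `[0%R, +oo[)
    (expR (- (r * t)))%:E = 1)%E.
  rewrite -(integral_exponential_pdf r0) -ge0_integralZl//; last exact: ltW.
  rewrite integral_mkcond; apply: eq_integral => t _.
  by rewrite /exponential_pdf !patchE; case: ifP => // _; rewrite mulNr -EFinM.
rewrite -[LHS]mul1e -(mulVf (lt0r_neq0 r0)) EFinM -muleA I1 mule1//.
Qed.

(** * Repair time and reward of a machine with two states *)

(** A chain that starts in k and can only jump to l: the case of a machine
with two states under repair, where k is the failed state and l the working
one. *)
Section SingleJump.
Context {R : realType} {d : measure_display} {Omega : measurableType d}.
Variables (P : probability Omega R) (S : finType) (q : S -> S -> R).
Variables (k l : S) (X : R -> Omega -> S) (r : R).
Hypotheses (ctmcX : is_ctmc P q k X) (r0 : 0 < r) (qkl : q k l = r)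
  (exit_k : exit_rate q k = r) (kl : k != l).

Lemma hitting_time_ge0 w : (0 <= hitting_time l X w)%E.
Proof. by apply: le_ereal_inf_tmp => _ [t [t0 _] <-]; rewrite lee_fin. Qed.

(** Take for H the first holding time and for E the event that the jump chain
starts with k, l and that the first two holding times are positive. On E the
chain is in k before time H and in l at time H; a positive second holding
time is what makes the state at time H that of the jump chain. *)
Lemma single_jump_hitting : exists (E : set Omega) (H : Omega -> R),
  [/\ measurable E, P E = 1%E, measurable_fun setT H,
   forall w, E w -> 0 <= H w /\ hitting_time l X w = (H w)%:E &
   forall t, 0 <= t -> P (E `&` [set w | t < H w]) = (expR (- (r * t)))%:E].
Proof.
case: ctmcX => Y [H [mY mH law XY]].
have mHt t n : measurable [set w | t < H n w].
  have -> : [set w | t < H n w] = setT `&` (H n) @^-1` `]t, +oo[.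
    by rewrite setTI; apply/seteqP; split => w /=; rewrite in_itv/= andbT.
  exact: mH.
pose E := [set w | (Y 0%N w = k /\ 0 < H 0%N w) /\ (Y 1%N w = l /\ 0 < H 1%N w)].
have mE : measurable E.
  have -> : E = ([set w | Y 0%N w = k] `&` [set w | 0 < H 0%N w]) `&`
                ([set w | Y 1%N w = l] `&` [set w | 0 < H 1%N w]) by [].
  apply: measurableI; apply: measurableI => //; exact: mY.
have PE : P E = 1%E.
  have := law 1%N (fun n => if n is 0 then k else l) (fun=> 0) (fun=> lexx 0).
  rewrite eqxx mul1r big_ord1 !big_ord_recr big_ord0/= !mulr0 oppr0 expR0.
  rewrite qkl exit_k divff ?lt0r_neq0// !mul1r => <-; congr (P _).
  apply/seteqP; split => w.
    by move=> [h0 h1] [|[|//]].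
  by move=> h; split; [exact: (h 0%N)|exact: (h 1%N)].
have P0 t : 0 <= t ->
    P [set w | Y 0%N w = k /\ t < H 0%N w] = (expR (- (r * t)))%:E.
  move=> t0.
  have := law 0%N (fun=> k) (fun=> t) (fun=> t0).
  rewrite eqxx mul1r big_ord0 big_ord_recr big_ord0/= !mul1r exit_k => <-.
  congr (P _); apply/seteqP; split => w.
    by move=> h [|//].
  by move=> h; exact: (h 0%N).
exists E, (H 0%N); split => //.
- move=> w [[Y0 H0] [Y1 H1]]; split; first exact: ltW.
  apply/eqP; rewrite eq_le; apply/andP; split.
    apply: ereal_inf_lbound; exists (H 0%N w) => //; split; first exact: ltW.
    rewrite -Y1; apply: XY; rewrite big_ord1 lexx !big_ord_recr big_ord0/=.
    by rewrite add0r ltrDl.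
  apply: le_ereal_inf_tmp => _ [t [t0 Xt] <-]; rewrite lee_fin leNgt.
  apply/negP => tH; move: kl; rewrite -Xt -Y0 (XY 0%N) ?eqxx//.
  by rewrite big_ord0 t0 big_ord1.
- move=> t t0; rewrite -(P0 _ t0).
  have mA : measurable [set w | Y 0%N w = k /\ t < H 0%N w].
    have -> : [set w | Y 0%N w = k /\ t < H 0%N w] =
      [set w | Y 0%N w = k] `&` [set w | t < H 0%N w] by [].
    exact: measurableI.
  have -> : E `&` [set w | t < H 0%N w] =
      [set w | Y 0%N w = k /\ t < H 0%N w] `&` E.
    by apply/seteqP; split => w; rewrite /E/=; tauto.
  apply/eqP; rewrite eq_le; apply/andP; split.
    by apply: le_measure; rewrite ?inE//; exact: measurableI.
  rewrite [leLHS](@measureDI _ _ _ P _ E)//.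
  rewrite [X in (X + _ <= _)%E](_ : _ = 0%E) ?add0e// /setD/=.
  apply/eqP; rewrite -measure_le0//; apply: (@le_trans _ _ (P (~` E))).
    apply: le_measure; rewrite ?inE//; last by move=> w [].
    - exact: measurableD.
    - exact: measurableC.
  by rewrite probability_setC// PE subee.
Qed.

(** The mean of an exponential time is the integral of its tail. With c = 1
this is the mean repair time, and with c a constant reward rate the mean
reward. *)
Lemma integral_single_jump_hitting (c : R) : 0 <= c ->
  (\int[P]_w (c%:E * hitting_time l X w) = (c / r)%:E)%E.
Proof.
move=> c0.
have [E [H [mE PE mH hitE tail]]] := single_jump_hitting.
pose g := fun w => if w \in E then H w else 0.
have g_ge0 w : 0 <= g w.
  by rewrite /g; case: ifPn => // /set_mem /hitE[].
have mg : measurable_fun setT g.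
  apply: measurable_fun_if => //.
  - by apply: (measurable_fun_bool true); rewrite setTI preimage_mem_true.
  - exact: measurable_funTS.
rewrite (@integral_eq_on_almost_sure _ _ _ P E _ (fun w => c%:E * (g w)%:E)%E)//.
- rewrite ge0_integralZl//; last 2 first.
  + exact/measurable_EFinP.
  + by move=> w _; rewrite lee_fin.
  pose gX : {RV P >-> R} := HB.pack g (isMeasurableFun.Build _ _ _ _ g mg).
  have -> : (\int[P]_w (g w)%:E = 'E_P[gX])%E by rewrite unlock.
  rewrite ge0_expectation_ccdf//.
  rewrite EFinM -(integral_expR_itvcy r0); congr (_ * _)%E.
  apply: eq_integral => t; rewrite inE/= in_itv/= andbT => t0.
  rewrite -(tail _ t0) /ccdf/= /distribution /pushforward; congr (P _).
  apply/seteqP; split => w /=; rewrite in_itv/= andbT /g.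
    by case: ifPn => [/set_mem //|_]; rewrite ltNge t0.
  by move=> [Ew]; rewrite mem_set.
- by move=> w; rewrite mule_ge0 ?hitting_time_ge0.
- by move=> w; rewrite mule_ge0 ?lee_fin.
- by apply: emeasurable_funM => //; exact/measurable_EFinP.
- by move=> w Ew; rewrite /g mem_set//; have [_ ->] := hitE _ Ew.
- by move=> w Ew; rewrite /g memNset ?mule0.
Qed.

End SingleJump.

Lemma reward_until_cst (R : realType) d (Omega : measurableType d) (S : finType)
    (l : S) (rho : S -> R) (c : R) (X : R -> Omega -> S) w :
  (forall s, rho s = c) ->
  reward_until l rho X w = (c%:E * hitting_time l X w)%E.
Proof.
move=> rhoc; rewrite /reward_until.
have h0 := hitting_time_ge0 l X w.
under eq_integral do rewrite rhoc.
case: (hitting_time l X w) h0 => [h|_|//].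
- rewrite lee_fin => h0.
  have -> : [set t : R | 0 <= t /\ (t%:E < h%:E)%E] = `[0, h[%classic.
    apply/seteqP; split => t /=; rewrite in_itv/= lte_fin; first by move=> [-> ->].
    by move=> /andP.
  rewrite integral_cst//= lebesgue_measure_itv/= lte_fin.
  case: ltP => [_|h_le0]; first by rewrite oppr0 adde0.
  by have -> : h = 0; [apply/eqP; rewrite eq_le h0 h_le0|rewrite mule0].
- have -> : [set t : R | 0 <= t /\ (t%:E < +oo)%E] = `[0, +oo[%classic.
    apply/seteqP; split => t /=; rewrite in_itv/= andbT ltry//; by case.
  by rewrite integral_cst//= lebesgue_measure_itv/= ltry.
Qed.

(** * Distances in a complete graph *)

Section CompleteGraph.
Variables (V : finType) (e : rel V).
Hypotheses (e_irr : irreflexive e) (e_complete : forall u v, u != v -> e u v).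

Lemma dist_complete (u v : V) : dist e u v = (u != v).
Proof.
have card_gt0 : (0 < #|V|)%N by rewrite (cardD1 u).
rewrite /dist; case: eqVneq => [<-|uv].
  case: #|V| card_gt0 => //= n _.
  by case: existsP => // -[]; exists [tuple]; rewrite /= eqxx.
have : (1 < #|V|)%N by rewrite (cardD1 u) (cardD1 v) !inE eq_sym uv.
case: #|V| => [|[|n]] //= _.
case: existsP => [[p]|_].
  by rewrite tuple0/= (negbTE uv).
case: existsP => // -[]; exists [tuple v] => /=.
by rewrite e_complete// eqxx.
Qed.

Lemma first_nodes_complete (u v : V) : first_nodes e u v = [set v]%SET.
Proof.
apply/setP => a; rewrite !inE dist_complete.
case: eqVneq => [<-|uv] /=.
  apply/existsP/eqP => [[p]|->].
    by rewrite tuple0/= eqxx => /eqP.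
  by exists [tuple] => /=; rewrite !eqxx.
apply/existsP/eqP => [[[[|b [|c p]] //= sp]]|->].
  by rewrite andbT => /and3P[_ /eqP -> /eqP].
by exists [tuple v] => /=; rewrite e_complete// !eqxx.
Qed.

End CompleteGraph.

(** * Indices of machines with two states *)

Section TwoStates.
Variables (R : realType) (G : repair_mdp R).
Variables (d : measure_display) (Omega : measurableType d) (P : probability Omega R).
Variable X : forall j : 'I_(nmach G), nat -> R -> Omega -> 'I_(kmax j).+1.
Hypotheses
  (XP : forall (j : 'I_(nmach G)) (k : 'I_(kmax j).+1),
     is_ctmc P (@repair_rate R G j) k (X j k))
  (two_states : forall j : 'I_(nmach G), kmax j = 1%N).

Lemma integral_hitting_two_states (j : 'I_(nmach G)) (c : R) : 0 <= c ->
  (\int[P]_w (c%:E * hitting_time ord0 (X j 1%N) w) = (c / mu j)%:E)%E.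
Proof.
move=> c0.
have [k k1] : exists k : 'I_(kmax j).+1, k = 1%N :> nat.
  by exists ord_max; exact: two_states.
have X1 : is_ctmc P (@repair_rate R G j) k (X j 1%N) by rewrite -k1; exact: XP.
have rk0 : repair_rate k ord0 = mu j by rewrite /repair_rate k1.
apply: (integral_single_jump_hitting X1) => //.
- exact: mu_gt0.
- rewrite /exit_rate (bigD1 ord0)//= rk0 big1 ?addr0// => l l0.
  have -> : l = k.
    apply: val_inj; rewrite /= k1.
    case: l l0 => -[//|[|l]] //= lK _; exfalso.
    by move: lK; rewrite ltnS two_states.
  by rewrite /repair_rate k1.
- by rewrite -val_eqE /= k1.
Qed.

Lemma ET1 (j : 'I_(nmach G)) : ET P X j 1 = (mu j)^-1.
Proof.
rewrite /ET/=; have := integral_hitting_two_states j ler01.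
by under eq_integral do rewrite mul1e; move=> ->; rewrite div1r.
Qed.

Lemma fcost1_gt0 (j : 'I_(nmach G)) : 0 < fcost j 1.
Proof. by rewrite -(fcost0 j) fcost_incr// two_states. Qed.

(** In both states the reward rate is mu f(1) / lam, so the reward of a
repair is this rate times the repair time. *)
Lemma ER1 (j : 'I_(nmach G)) : ER P X j 1 = fcost j 1 / lam j.
Proof.
have srateE (l : 'I_(kmax j).+1) : srate j l = mu j * fcost j 1 / lam j.
  have l1 : l.-1 = 0%N by case: l => -[|[|l]] //=; rewrite two_states.
  by rewrite /srate l1 fcost0 subr0 two_states.
rewrite /ER/=.
under eq_integral do rewrite (reward_until_cst _ _ _ srateE).
rewrite integral_hitting_two_states; last first.
  by rewrite !mulr_ge0 ?invr_ge0 // ltW // ?mu_gt0 ?lam_gt0 ?fcost1_gt0.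
rewrite /=; field.
by rewrite !lt0r_neq0 ?mu_gt0 ?lam_gt0.
Qed.

Lemma Phi_stay1 (j : 'I_(nmach G)) : Phi_stay P X j 1 = mu j * fcost j 1 / lam j.
Proof.
rewrite /Phi_stay/= ET1 ER1; field.
by rewrite !lt0r_neq0 ?mu_gt0 ?lam_gt0.
Qed.

Hypothesis complete : forall u v : node G, u != v -> adj u v.

Lemma dm1 i (j : 'I_(nmach G)) : i != loc j -> dm i j = 1%N.
Proof. by move=> ij; rewrite /dm dist_complete// ij. Qed.

Lemma Phi_move1 i (j : 'I_(nmach G)) : i != loc j ->
  Phi_move P X i j 1 = fcost j 1 / lam j / ((tau G)^-1 + (mu j)^-1).
Proof.
move=> ij; rewrite /Phi_move two_states big_nat1 /PX /EDX two_states ltnn.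
by rewrite !big_geq// !subr0 mul1r divr1 ET1 ER1 /ED dm1// div1r.
Qed.

Lemma Phi_wait1 i (j : 'I_(nmach G)) : i != loc j ->
  Phi_wait P X i j 1 =
  fcost j 1 / lam j / ((lam j)^-1 + (tau G)^-1 + (mu j)^-1).
Proof.
move=> ij; rewrite /Phi_wait two_states big_geq// add0r /PX /EDX two_states ltnn.
by rewrite !big_geq// !subr0 mul1r divr1 ET1 ER1 /ED dm1// div1r.
Qed.

(** Waiting before the trip to a failed machine only postpones the same
reward. *)
Lemma Phi_wait1_move1 i (j : 'I_(nmach G)) : i != loc j ->
  Phi_wait P X i j 1 <= Phi_move P X i j 1.
Proof.
move=> ij; rewrite Phi_wait1// Phi_move1//.
have := lam_gt0 j; have := mu_gt0 j; have := tau_gt0 G; have := fcost1_gt0 j.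
move=> f0 t0 m0 l0.
apply: ler_wpM2l; first by rewrite divr_ge0// ltW.
by rewrite lef_pV2 ?posrE ?addr_gt0 ?invr_gt0// -addrA lerDr invr_ge0 ltW.
Qed.

(** The repair is worth the same with and without a trip before it. *)
Lemma Phi_move1_stay1 i (j : 'I_(nmach G)) : i != loc j ->
  Phi_move P X i j 1 < Phi_stay P X j 1.
Proof.
move=> ij; rewrite Phi_stay1 Phi_move1//.
have := lam_gt0 j; have := mu_gt0 j; have := tau_gt0 G; have := fcost1_gt0 j.
move=> f0 t0 m0 l0.
rewrite [ltRHS](_ : _ = fcost j 1 / lam j / (mu j)^-1); last first.
  by field; rewrite !lt0r_neq0.
rewrite ltr_pM2l ?divr_gt0// ltf_pV2 ?posrE ?addr_gt0 ?invr_gt0//.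
by rewrite ltrDr invr_gt0.
Qed.

(** A trip to a working machine is rewarded only if the machine fails on the
way, which has probability lam / (lam + tau) < 1, and given this event the
trip takes 1 / (lam + tau) longer on average. *)
Lemma Phi_move0_move1 i (j : 'I_(nmach G)) : i != loc j ->
  Phi_move P X i j 0 < Phi_move P X i j 1.
Proof.
move=> ij; rewrite Phi_move1// /Phi_move two_states.
have ER0 : ER P X j 0 = 0 by [].
rewrite big_nat_recr//= big_nat1 ER0 mul0r mulr0 add0r.
rewrite /PX /EDX /EDX_lt /PX_lt two_states ltnn !big_nat1 ET1 ER1 /ED dm1//.
rewrite subnn bin0 expr0 expr1 addn0 subn0.
have := lam_gt0 j; have := mu_gt0 j; have := tau_gt0 G; have := fcost1_gt0 j.
move=> f0 t0 m0 l0.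
(* p is the probability of a failure during the trip, and DE below computes the
   mean length of the trip given that there is one. *)
set p := 1 - _.
have pE : p = lam j / (lam j + tau G).
  by rewrite /p; field; rewrite lt0r_neq0 ?addr_gt0.
have DE : (1%:R / tau G
      - 1%:R * (tau G / (lam j + tau G)) * 1 * (1%:R / (tau G + lam j))) / p
    = (tau G)^-1 + (lam j + tau G)^-1.
  by rewrite pE; field; rewrite !lt0r_neq0 ?addr_gt0.
rewrite DE.
apply: (@lt_trans _ _
  (fcost j 1 / lam j / ((tau G)^-1 + (lam j + tau G)^-1 + (mu j)^-1))).
  rewrite -[ltRHS]mul1r ltr_pM2r; last first.
    by rewrite !(divr_gt0, addr_gt0, invr_gt0).
  by rewrite pE ltr_pdivrMr ?addr_gt0// mul1r ltrDl.
rewrite ltr_pM2l ?divr_gt0// ltf_pV2 ?posrE ?addr_gt0 ?invr_gt0 ?addr_gt0//.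
by rewrite -addrA ltrD2l ltrDr invr_gt0 addr_gt0.
Qed.

End TwoStates.

(** * Actions of the index policy *)

Section IndexAction.
Variables (R : realType) (G : repair_mdp R).
Variables (d : measure_display) (Omega : measurableType d) (P : probability Omega R).
Variable X : forall j : 'I_(nmach G), nat -> R -> Omega -> 'I_(kmax j).+1.
Variables (prio : seq (node G)) (prioP : perm_eq prio (enum (node G))).
Hypotheses
  (XP : forall (j : 'I_(nmach G)) (k : 'I_(kmax j).+1),
     is_ctmc P (@repair_rate R G j) k (X j k))
  (complete : forall u v : node G, u != v -> adj u v)
  (two_states : forall j : 'I_(nmach G), kmax j = 1%N)
  (same_lam : forall j l : 'I_(nmach G), lam j = lam l)
  (same_mu : forall j l : 'I_(nmach G), mu j = mu l)
  (same_f : forall j l : 'I_(nmach G), fcost j 1%N = fcost l 1%N).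

Lemma mem_index_action (x : state G) :
  viable P X x != finset.set0 -> index_action P X prio x \in viable P X x.
Proof.
case/set0Pn => a av; rewrite /index_action.
have := filter_all (mem (viable P X x)) prio.
have : a \in [seq b <- prio | b \in viable P X x].
  by rewrite mem_filter av (perm_mem prioP) mem_enum.
by case: [seq _ <- _ | _] => [|b s _ /= /andP[]].
Qed.

Lemma state1 (x : state G) j : x.2 j != 0%N :> nat -> x.2 j = 1%N :> nat.
Proof. by case: (x.2 j) => -[|[|n]] //= ; rewrite two_states. Qed.

(** From a machine the distance to one of the machines is 0 and the others
are 1, whereas from an intermediate stage all of them are 1. *)
Lemma Psi_min_machine (v : node G) :
  (forall u, @Psi R G v <= @Psi R G u) -> exists j : 'I_(nmach G), v = loc j.
Proof.
move=> vmin.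
have [[j /eqP vj]|no] := pselect (exists j : 'I_(nmach G), v == loc j).
  by exists j.
have j0 : 'I_(nmach G) by exact: (Ordinal (ltn_trans (ltn0Sn 0) (nmach_ge2 G))).
have vj (j : 'I_(nmach G)) : v != loc j by apply/negP => vj; apply: no; exists j.
have lamsum : 0 < \sum_(l < nmach G) lam l.
  rewrite (bigD1 j0)//= ltr_pwDl ?lam_gt0// sumr_ge0// => l _.
  exact/ltW/lam_gt0.
have := vmin (loc j0); rewrite leNgt => /negP[].
rewrite /Psi [ltLHS](bigD1 j0)//= [ltRHS](bigD1 j0)//= ltr_leD//.
  rewrite /ED (dm1 complete (vj j0)) /dm dist_complete// eqxx mul0r mulr0.
  by rewrite !(mulr_gt0, invr_gt0) ?lam_gt0 ?tau_gt0.
apply: ler_sum => j _; rewrite ler_wpM2l ?divr_ge0 ?(ltW lamsum) ?(ltW (lam_gt0 _))//.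
rewrite /ED (dm1 complete (vj j)) ler_pM2r ?invr_gt0 ?tau_gt0// ler_nat.
by rewrite /dm dist_complete// leq_b1.
Qed.

(** By symmetry every machine minimizes Psi, so the policy may well leave one
working machine for another; only the arrival at some machine matters. *)
Lemma index_action_idle (x : state G) :
  (forall j, x.2 j = 0%N :> nat) -> exists j, index_action P X prio x = loc j.
Proof.
move=> x0.
have vE : viable P X x = [set v | [forall u, @Psi R G v <= @Psi R G u]]%SET.
  rewrite /viable ifT; last by apply/forallP => j; rewrite x0.
  apply/setP => a; rewrite inE; apply/bigcupP/idP => [[v vmin]|amin].
    by rewrite first_nodes_complete// inE => /eqP ->.
  by exists a => //; rewrite first_nodes_complete// set11.
have /mem_index_action : viable P X x != finset.set0.
  rewrite vE; apply/set0Pn.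
  have [v _ vmin] := @arg_minP _ R (node G) x.1 predT (@Psi R G) isT.
  by exists v; rewrite inE; apply/forallP => u; exact: vmin.
by rewrite vE inE => /forallP /Psi_min_machine.
Qed.

Lemma Phi_move1_same i (j l : 'I_(nmach G)) : i != loc j -> i != loc l ->
  Phi_move P X i j 1 = Phi_move P X i l 1.
Proof.
by move=> ij il; rewrite !Phi_move1// (same_lam j l) (same_mu j l) (same_f j l).
Qed.

(** No trip has a higher index than a trip to a failed machine, and the index
for staying exceeds even that one. *)
Lemma index_action_stay (x : state G) j :
  x.1 = loc j -> x.2 j != 0%N :> nat -> index_action P X prio x = x.1.
Proof.
move=> xj xj0.
have vE : viable P X x = [set x.1]%SET.
  rewrite /viable ifF; last by apply/negbTE/forallPn; exists j.
  case: pickP => [j0|/(_ j)]; last by rewrite xj eqxx.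
  rewrite xj => /eqP /loc_inj -> {j0}.
  rewrite ifT//; apply/eqP/setP => l; rewrite !inE.
  apply/negbTE; rewrite !negb_and -leNgt.
  case: eqVneq => //= lj; rewrite orbA; apply/orP; right; apply/ltW.
  have jl : loc j != loc l by apply: contraNneq lj => /loc_inj ->.
  rewrite (state1 xj0) -xj; move: jl; rewrite -xj => jl.
  apply: (@le_lt_trans _ _ (Phi_move P X x.1 l 1)).
    have [->|/state1 ->//] := eqVneq (x.2 l : nat) 0%N.
    by apply/ltW/Phi_move0_move1.
  have := Phi_move1_stay1 XP two_states complete jl.
  by rewrite !(Phi_stay1 XP)// (same_lam j l) (same_mu j l) (same_f j l).
have /mem_index_action : viable P X x != finset.set0.
  by rewrite vE -card_gt0 cards1.
by rewrite vE => /set1P.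
Qed.

(** With nothing to repair on the spot, the failed machines are exactly the
maximizers of the move index, and each passes the test against waiting. *)
Lemma index_action_travel (x : state G) l :
  x.2 l != 0%N :> nat -> (forall j, x.1 = loc j -> x.2 j = 0%N :> nat) ->
  exists2 j, x.2 j != 0%N :> nat & index_action P X prio x = loc j.
Proof.
move=> xl xN.
have notat j : x.2 j != 0%N :> nat -> x.1 != loc j.
  by apply: contraNneq => /xN ->.
suff vE : viable P X x = [set loc j | j in [set j | x.2 j != 0%N :> nat]]%SET.
  have /mem_index_action : viable P X x != finset.set0.
    by rewrite vE; apply/set0Pn; exists (loc l); apply: imset_f; rewrite inE.
  by rewrite vE => /imsetP[j]; rewrite inE => xj ->; exists j.
have towardsE (B : {set 'I_(nmach G)}) :
  (\bigcup_(j in B) first_nodes (@adj R G) x.1 (loc j))%SET =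
  [set loc j | j in B]%SET.
  apply/setP => a; apply/bigcupP/imsetP => -[j jB].
    by rewrite first_nodes_complete// inE => /eqP ->; exists j.
  by move=> ->; exists j => //; rewrite first_nodes_complete// set11.
have move_le j k : x.2 j != 0%N :> nat -> x.1 != loc k ->
    Phi_move P X x.1 k (x.2 k) <= Phi_move P X x.1 j (x.2 j)
      ?= iff (x.2 k != 0%N :> nat).
  move=> xj xk; rewrite (state1 xj).
  rewrite (Phi_move1_same (notat _ xj) xk).
  have [->|/state1 ->] := eqVneq (x.2 k : nat) 0%N; last by apply/leifP => /=.
  by apply/leifP => /=; apply: Phi_move0_move1.
rewrite /viable ifF; last by apply/negbTE/forallPn; exists l.
case: pickP => [j0 /eqP j0x|noloc]; rewrite !towardsE.
  have j0neq j : j != j0 -> x.1 != loc j.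
    by apply: contraNneq; rewrite -j0x => /loc_inj ->.
  have x0 : x.2 j0 = 0%N :> nat by exact: xN.
  set best := [set j in _ | _]%SET.
  suff bestE : best = [set j | x.2 j != 0%N :> nat]%SET.
    rewrite bestE ifF//; apply/negbTE/set0Pn; exists l; by rewrite inE.
  have inJ j : x.2 j != 0%N :> nat -> (j != j0) /\ 
     (Phi_wait P X x.1 j (x.2 j) <= Phi_move P X x.1 j (x.2 j)).
    move=> xj; split; first by apply: contraNneq xj => ->; rewrite x0.
    by rewrite (state1 xj); apply: Phi_wait1_move1 => //; exact: notat.
  apply/setP => j; rewrite !inE x0 /Phi_stay/=; apply/idP/idP.
    case/and3P => /andP[jj0 _] /forallP/(_ l)/implyP + _.
    have [lj0 wl] := inJ _ xl; rewrite !inE lj0 wl => /(_ isT) mlj.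
    by have := ge_leif (move_le l j xl (j0neq _ jj0)); rewrite mlj => <-.
  move=> xj; have [jj0 wj] := inJ _ xj; rewrite jj0 wj/=; apply/andP; split.
    apply/forallP => k; apply/implyP; rewrite !inE => /andP[kj0 _].
    exact: (move_le _ _ xj (j0neq _ kj0)).
  rewrite (state1 xj) Phi_move1//; last exact: notat.
  rewrite !(divr_gt0, addr_gt0, invr_gt0) ?fcost1_gt0 ?lam_gt0 ?mu_gt0 ?tau_gt0//.
set best := [set j | _]%SET.
suff -> : best = [set j | x.2 j != 0%N :> nat]%SET by [].
apply/setP => j; rewrite !inE.
have xj k : x.1 != loc k by rewrite eq_sym noloc.
apply/forallP/idP => [/(_ l) mlj|xjb k]; last exact: move_le.
by have := ge_leif (move_le l j xl (xj _)); rewrite mlj => <-.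
Qed.

End IndexAction.

(** * Costs over a finite horizon *)

Lemma sum_tuple_pair_cons (R : nmodType) (T U : finType) n
    (F : n.+1.-tuple (T * U) -> R) :
  \sum_w F w =
  \sum_a \sum_b \sum_(w : n.-tuple (T * U)) F [tuple of (a, b) :: w].
Proof.
rewrite !pair_big/=.
rewrite (reindex (fun p : T * U * n.-tuple (T * U) => [tuple of p.1 :: p.2]))/=.
  by apply: eq_bigr => -[[a b] w].
exists (fun w => (thead w, [tuple of behead w])) => [[a w] _|w _].
  by congr (_, _); apply: val_inj.
by rewrite -tuple_eta.
Qed.

Section FiniteHorizon.
Variables (R : realType) (G : repair_mdp R).

Local Notation V := (node G).
Local Notation machine := 'I_(nmach G).

(** The past h is a parameter so that the costs of a policy satisfy a
recursion on the horizon; [expected_cost] is the case of an empty past. *)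
Definition cost_to_go (theta : policy G) h (x : state G) (t : nat) : R :=
  \sum_(w : t.-tuple (V * state G)%type)
    traj_prob theta h x w * \sum_(z <- belast x (unzip2 w)) cost z.

(** The expected value after one step is the present value plus the expected
gains of the jumps, as for the generator of a continuous-time chain; the
probability of standing still disappears from the formula. *)
Lemma sum_trans_mul (a : V) (x : state G) (F : state G -> R) :
  \sum_y trans a x y * F y = F x + \sum_(y | y != x) rate_to a x y * (F y - F x).
Proof.
rewrite (bigD1 x)//= {1}/trans eqxx.
under eq_bigr => y /negbTE yx do rewrite /trans yx.
rewrite mulrBl mul1r -addrA mulr_suml; congr (_ + _).
rewrite addrC -sumrB; apply: eq_bigr => y _; by rewrite mulrBr.
Qed.

Lemma sum_trans (a : V) (x : state G) : \sum_y trans a x y = 1.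
Proof.
under eq_bigr do rewrite -[trans _ _ _]mulr1.
rewrite (sum_trans_mul a x (fun=> 1)) big1 ?addr0// => y _.
by rewrite subrr mulr0.
Qed.

Lemma sum_traj_prob (theta : policy G) t h x :
  \sum_(w : t.-tuple (V * state G)%type) traj_prob theta h x w = 1.
Proof.
elim: t h x => [|t IH] h x.
  by rewrite (big_pred1 [tuple]) // => w; apply/esym/eqP; exact: tuple0.
rewrite sum_tuple_pair_cons.
rewrite -[RHS](pol_sum1 theta h x); apply: eq_bigr => a _.
under eq_bigr do rewrite -mulr_sumr IH mulr1.
by rewrite -mulr_sumr sum_trans mulr1.
Qed.

Lemma cost_to_go0 theta h x : cost_to_go theta h x 0 = 0.
Proof. by rewrite /cost_to_go big1// => -[[]]// i _; rewrite big_nil mulr0. Qed.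

Lemma cost_to_goS theta h x t :
  cost_to_go theta h x t.+1 =
  cost x + \sum_a theta h x a *
    \sum_y trans a x y * cost_to_go theta (rcons h (x, a)) y t.
Proof.
rewrite /cost_to_go sum_tuple_pair_cons.
transitivity (\sum_a (theta h x a * cost x + theta h x a *
    \sum_y trans a x y * cost_to_go theta (rcons h (x, a)) y t)).
  apply: eq_bigr => a _.
  rewrite -mulrDr -[X in X + _]mul1r -(sum_trans a x) mulr_suml -big_split/=.
  rewrite mulr_sumr; apply: eq_bigr => y _.
  rewrite -[X in X * cost x]mulr1 -(sum_traj_prob theta t (rcons h (x, a)) y).
  rewrite -mulrA -mulrDr mulrA mulr_suml -big_split/= mulr_sumr.
  by apply: eq_bigr => w _; rewrite big_cons mulrDr -!mulrA -!mulrDr.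
by rewrite big_split/= -mulr_suml pol_sum1 mul1r.
Qed.

Definition set_condition (x : state G) (j : machine) (v : nat) : state G :=
  (x.1, finfun (fun l : machine => if l == j then inord v else x.2 l)).

Lemma set_condition_same x j v : (v <= kmax j)%N ->
  (set_condition x j v).2 j = v :> nat.
Proof. by move=> vK; rewrite ffunE eqxx inordK. Qed.

Lemma set_condition_other x j v l : l != j -> (set_condition x j v).2 l = x.2 l.
Proof. by move=> /negbTE lj; rewrite ffunE lj. Qed.

Lemma eq_set_condition x y j v : (v <= kmax j)%N ->
  (y == set_condition x j v) =
  [&& y.1 == x.1, y.2 j == v :> nat & agree_off j x y].
Proof.
move=> vK; apply/eqP/and3P => [->|[/eqP y1 /eqP yj /forallP yoff]].
  split; rewrite ?set_condition_same//.
  by apply/forallP => l; apply/implyP => lj; rewrite set_condition_other.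
case: y y1 yj yoff => y1 y2/= -> yj yoff; congr (_, _); apply/ffunP => l.
rewrite ffunE; case: eqVneq => [->|lj].
  by apply: val_inj; rewrite /= yj inordK.
exact/eqP/(implyP (yoff l)).
Qed.

Lemma degradationE (x y : state G) j :
  degradation x y j =
  (x.2 j < kmax j)%N && (y == set_condition x j (x.2 j).+1).
Proof.
case: (ltnP (x.2 j) (kmax j)) => xK; first by rewrite eq_set_condition.
apply/negbTE/negP => /and3P[_ /eqP yj _].
by have := ltn_ord (y.2 j); rewrite yj !ltnS ltnNge xK.
Qed.

Lemma repairE a (x y : state G) j :
  repair a x y j =
  [&& loc j == x.1, a == x.1, (0 < x.2 j)%N & y == set_condition x j (x.2 j).-1].
Proof.
rewrite /repair eq_set_condition; last first.
  by rewrite (leq_trans (leq_pred _))// -ltnS.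
case: (x.2 j : nat) => [|n] /=; first by rewrite !andbF.
rewrite eqSS [n == _]eq_sym.
by case: (loc j == _); case: (a == _); case: (y.1 == _); case: (_ == n);
  rewrite ?andbF ?andbT.
Qed.

Lemma switchE a (x y : state G) : switch a x y = adj x.1 a && (y == (a, x.2)).
Proof.
case: y => y1 y2; rewrite /switch/= xpair_eqE [a == _]eq_sym.
by case: (eqVneq y1 a) => [->|_]; rewrite ?andbF// andbT.
Qed.

(** At most one of the transitions from x leads to y, so the nested case
analysis defining the rates is a sum over the possible causes. *)
Lemma rate_toE a (x y : state G) :
  rate_to a x y = \sum_(j | degradation x y j) lam j
    + \sum_(j | repair a x y j) mu j + (if switch a x y then tau G else 0).
Proof.
rewrite /rate_to; case: pickP => [j dj|nodeg].
  have /and3P[/eqP y1 /eqP yj /forallP yoff] := dj.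
  rewrite (big_pred1 j) => [|l]; last first.
    apply/idP/eqP => [/and3P[_ /eqP yl _]|->//].
    apply/eqP; apply: contra_eqT yl => lj.
    by rewrite (eqP (implyP (yoff l) lj)) eq_sym gtn_eqF.
  rewrite big_pred0 => [|l]; last first.
    apply/negbTE/negP => /and5P[_ _ /eqP xl _ _].
    have [lj|lj] := eqVneq l j; last first.
      by move: xl; rewrite (eqP (implyP (yoff l) lj)); apply/n_Sn.
    by move: xl; rewrite lj yj => /eqP; rewrite ltn_eqF.
  rewrite /switch; case: eqP => [y2|_]; last by rewrite andbF !addr0.
  by move: yj; rewrite y2 => /eqP; rewrite ltn_eqF.
rewrite big_pred0// add0r; case: pickP => [j rj|norep].
  have /and5P[/eqP jx /eqP y1 /eqP xj /forallP yoff _] := rj.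
  rewrite (big_pred1 j) => [|l]; last first.
    apply/idP/eqP => [/and5P[/eqP lx _ _ _ _]|->//].
    by apply: loc_inj; rewrite lx.
  by rewrite /switch y1 adj_irr/= addr0.
by rewrite big_pred0// add0r.
Qed.

Lemma sum_rate_to a (x : state G) (F : state G -> R) :
  \sum_(y | y != x) rate_to a x y * F y =
    \sum_(j | (x.2 j < kmax j)%N) lam j * F (set_condition x j (x.2 j).+1)
  + \sum_(j | [&& loc j == x.1, a == x.1 & (0 < x.2 j)%N])
      mu j * F (set_condition x j (x.2 j).-1)
  + (if adj x.1 a then tau G * F (a, x.2) else 0).
Proof.
under eq_bigr do rewrite rate_toE 2!mulrDl !mulr_suml.
rewrite !big_split/=; congr (_ + _ + _).
- under eq_bigr do rewrite big_mkcond/=.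
  rewrite exchange_big/= [RHS]big_mkcond/=; apply: eq_bigr => j _.
  rewrite -big_mkcondr/=; case: ifPn => xK.
    rewrite (big_pred1 (set_condition x j (x.2 j).+1))// => y.
    rewrite degradationE xK/=.
    case: (eqVneq y (set_condition _ _ _)) => [->|]; rewrite ?andbF// andbT.
    apply/eqP => /(congr1 (fun z : state G => z.2 j : nat)).
    by rewrite set_condition_same// => /esym/n_Sn.
  by rewrite big_pred0// => y; rewrite degradationE (negbTE xK) andbF.
- under eq_bigr do rewrite big_mkcond/=.
  rewrite exchange_big/= [RHS]big_mkcond/=; apply: eq_bigr => j _.
  rewrite -big_mkcondr/=; case: ifPn => [/and3P[jx ax x0]|no].
    rewrite (big_pred1 (set_condition x j (x.2 j).-1))// => y.
    rewrite repairE jx ax x0/=.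
    case: (eqVneq y (set_condition _ _ _)) => [->|]; rewrite ?andbF// andbT.
    apply/eqP => /(congr1 (fun z : state G => z.2 j : nat)).
    rewrite set_condition_same//; last by rewrite (leq_trans (leq_pred _))// -ltnS.
    by move: x0; case: (x.2 j : nat) => // n _ /= /n_Sn.
  rewrite big_pred0// => y; apply: contraNF no => /andP[_].
  by rewrite repairE => /and4P[-> -> -> _].
- case: ifPn => xa.
    rewrite (bigD1 (a, x.2))/=; last first.
      by apply: contraTneq xa => <-/=; rewrite adj_irr.
    rewrite switchE xa eqxx/= big1 ?addr0// => y /andP[_ /negbTE ya].
    by rewrite switchE ya andbF mul0r.
  by rewrite big1// => y _; rewrite switchE (negbTE xa) mul0r.
Qed.

Lemma rate_to_ge0 a (x y : state G) : 0 <= rate_to a x y.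
Proof.
rewrite rate_toE !addr_ge0//.
- by apply: sumr_ge0 => j _; exact/ltW/lam_gt0.
- by apply: sumr_ge0 => j _; exact/ltW/mu_gt0.
- by case: ifP => // _; exact/ltW/tau_gt0.
Qed.

(** This is where the normalization of the rates enters: the total rate out
of a state is at most the sum of all lam j plus one of mu j, tau, because
repairing and moving exclude each other. *)
Lemma trans_ge0 a (x y : state G) : 0 <= trans a x y.
Proof.
rewrite /trans; case: ifP => _; last exact: rate_to_ge0.
rewrite subr_ge0.
under eq_bigr do rewrite -[rate_to _ _ _]mulr1.
rewrite (sum_rate_to a x (fun=> 1)) -[leRHS](uniformized G) -addrA lerD//.
  under eq_bigr do rewrite mulr1.
  rewrite [leRHS](bigID (fun j => (x.2 j < kmax j)%N))/= lerDl.
  by apply: sumr_ge0 => j _; exact/ltW/lam_gt0.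
have tau_le : tau G <= \big[Num.max/tau G]_(j : machine) mu j.
  exact: bigmax_ge_id.
case: (eqVneq a x.1) => [->|ax].
  rewrite adj_irr addr0.
  have [[j jx]|no] := pselect (exists j : machine, loc j = x.1).
    rewrite big_mkcond (bigD1 j)//= big1 ?addr0 => [|l lj].
      case: ifP => _; rewrite ?mulr1; last exact: le_trans (ltW (tau_gt0 _)) tau_le.
      exact: (le_bigmax _ _ j).
    by rewrite -jx (inj_eq (@loc_inj _ _)) (negbTE lj).
  rewrite big_pred0 => [|j]; first exact: le_trans (ltW (tau_gt0 _)) tau_le.
  by case: eqP => // jx; case: no; exists j.
rewrite big_pred0 ?add0r; last by move=> j; rewrite andbF.
by case: ifP => _; rewrite ?mulr1//; exact: le_trans (ltW (tau_gt0 _)) tau_le.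
Qed.

(** Backward induction: subsolutions of the finite-horizon optimality
equations bound the cost of all policies, randomized and history-dependent
ones included. *)
Lemma cost_to_go_ge (W : nat -> state G -> R) :
  (forall x, W 0%N x = 0) ->
  (forall t x a, a \in actions x ->
     W t.+1 x <= cost x + \sum_y trans a x y * W t y) ->
  forall theta h x t, W t x <= cost_to_go theta h x t.
Proof.
move=> W0 WS theta h x t; elim: t h x => [|t IH] h x.
  by rewrite cost_to_go0 W0.
rewrite cost_to_goS -lerBlDl -[leLHS]mul1r -(pol_sum1 theta h x) mulr_suml.
apply: ler_sum => a _; have [aA|aA] := boolP (a \in actions x); last first.
  by rewrite pol_actions// !mul0r.
apply: ler_wpM2l; first exact: pol_ge0.
rewrite lerBlDl; apply: le_trans (WS _ _ _ aA) _; rewrite lerD2l.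
by apply: ler_sum => y _; rewrite ler_wpM2l ?trans_ge0.
Qed.

Lemma cost_to_go_stationary (W : nat -> state G -> R)
    (d : state G -> V) (dA : forall x, d x \in actions x) :
  (forall x, W 0%N x = 0) ->
  (forall t x, W t.+1 x = cost x + \sum_y trans (d x) x y * W t y) ->
  forall h x t, cost_to_go (stationary dA) h x t = W t x.
Proof.
move=> W0 WS h x t; elim: t h x => [|t IH] h x.
  by rewrite cost_to_go0 W0.
rewrite cost_to_goS WS (bigD1 (d x))//= /stationary_prob eqxx mul1r.
rewrite [X in _ + (_ + X)]big1 ?addr0 => [|a /negbTE ->]; last by rewrite mul0r.
by congr (_ + _); apply: eq_bigr => y _; rewrite IH.
Qed.

Lemma le_limn_einf (u v : nat -> \bar R) :
  (forall n, u n <= v n)%E -> (limn_einf u <= limn_einf v)%E.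
Proof.
move=> uv; rewrite !limn_einf_lim; apply: lee_lim.
- exact: is_cvg_einfs.
- exact: is_cvg_einfs.
apply: nearW => n; apply: le_ereal_inf_tmp => _ [k nk <-].
by apply: le_trans (uv k); apply: ereal_inf_lbound; exists k.
Qed.

Lemma le_avg_cost (theta theta' : policy G) x :
  (forall t, expected_cost theta x t <= expected_cost theta' x t) ->
  (avg_cost theta x <= avg_cost theta' x)%E.
Proof.
move=> le_t; apply: le_limn_einf => t; rewrite lee_fin ler_wpM2l//.
Qed.

End FiniteHorizon.

(** * Costs by site and number of failed machines *)

(** Up to the symmetry between the machines and between the intermediate
stages, a state is the site of the repairer together with the number of
failed machines. *)
Inductive site := AtFailed | AtWorking | AtStage.

Definition best_site_value (R : realType) (v : site -> nat -> R) (k : nat) : R :=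
  if k == 0%N then v AtWorking 0%N else v AtFailed k.

Section ClassValue.
Variables (R : realType) (m : nat) (lam mu tau c : R).

(** The cost over t steps when k of m machines have failed and the repairer
repairs where he can and otherwise moves to the best site. Terms with k.+1 at
k = m and with k.-1 at k = 0 occur only with a zero coefficient or in a class
that is empty. *)
Fixpoint class_value (t : nat) (s : site) (k : nat) : R :=
  if t is t.+1 then
    let v := class_value t in
    c * k%:R + v s k +
    match s with
    | AtFailed =>
        (m - k)%:R * lam * (v AtFailed k.+1 - v AtFailed k)
        + mu * (v AtWorking k.-1 - v AtFailed k)
    | AtWorking =>
        lam * (v AtFailed k.+1 - v AtWorking k)
        + (m - k.+1)%:R * lam * (v AtWorking k.+1 - v AtWorking k)
        + tau * (best_site_value v k - v AtWorking k)
    | AtStage =>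
        (m - k)%:R * lam * (v AtStage k.+1 - v AtStage k)
        + tau * (best_site_value v k - v AtStage k)
    end
  else 0.

Hypotheses (lam0 : 0 <= lam) (mu0 : 0 <= mu) (tau0 : 0 <= tau) (c0 : 0 <= c)
  (mu_le : m%:R * lam + mu <= 1) (tau_le : m%:R * lam + tau <= 1).

(** The ranges of k are those where both sides belong to states that exist.
*)
Definition ordered_classes (v : site -> nat -> R) :=
  [/\ forall k, (k < m)%N -> v AtWorking k <= v AtFailed k.+1,
      forall k, (0 < k < m)%N -> v AtFailed k <= v AtWorking k,
      forall k, (0 < k <= m)%N -> v AtFailed k <= v AtStage k &
      forall k, (k < m)%N -> v AtWorking k <= v AtStage k].

(** Subtract the recursions of the two sides. The failure terms pair up into
nonnegative multiples of differences of the same kind, with one more failed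
machine. The control terms leave a multiple 1 - p k - mu or 1 - p k - tau of
the difference itself, which is nonnegative by the normalization of the
rates, and, except in the last inequality, the gain of one of the two
controls, which is nonnegative by another of the inequalities; so they need a
joint induction. *)
Lemma class_value_ordered t : ordered_classes (class_value t).
Proof.
elim: t => [|t IH]; first by split.
move: IH => /=; set v := class_value t => -[WF FW FS WS].
have mulD_ge0 (a x y : R) : 0 <= a -> x <= y -> 0 <= a * (y - x).
  by move=> a0 xy; rewrite mulr_ge0// subr_ge0.
pose p k : R := (m - k)%:R * lam.
have pE k : p k = (m - k)%:R * lam by [].
have p_ge0 k : 0 <= p k by rewrite mulr_ge0.
have p_le k : p k <= m%:R * lam by rewrite ler_wpM2r// ler_nat leq_subr.
have p_mu k : 0 <= 1 - p k - mu.
  by rewrite -addrA -opprD subr_ge0 (le_trans _ mu_le)// lerD2r.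
have p_tau k : 0 <= 1 - p k - tau.
  by rewrite -addrA -opprD subr_ge0 (le_trans _ tau_le)// lerD2r.
(* One of the m - k working machines is the one where the repairer is. *)
have pS k : (k < m)%N -> p k = lam + p k.+1.
  by move=> km; rewrite /p -(subnSK km) -natr1; ring.
have p_mul k (x y : R) : ((k < m)%N -> x <= y) -> 0 <= p k * (y - x).
  move=> xy; have [/xy xy'|mk] := ltnP k m; first exact: mulD_ge0.
  by rewrite /p (eqP (_ : m - k == 0)%N) ?subn_eq0// !mul0r.
split=> [k km|k /andP[k0 km]|k /andP[k0 km]|k km] /=; rewrite -?pE.
- have h1 : 0 <= (1 - p k - mu) * (v AtFailed k.+1 - v AtWorking k).
    by apply: mulD_ge0; [|exact: WF].
  have h2 : 0 <= p k.+1 * (v AtFailed k.+2 - v AtWorking k.+1).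
    by apply: p_mul => k1m; exact: WF.
  have h3 : 0 <= tau * (v AtWorking k - best_site_value v k).
    by rewrite mulD_ge0// /best_site_value; case: k km {h1 h2} => // k km; exact: FW.
  rewrite -natr1; rewrite (pS _ km) in h1 *.
  by generalize (k%:R : R) => kR; move: c0 => c1; lra.
- have h1 : 0 <= (1 - p k - tau) * (v AtWorking k - v AtFailed k).
    by apply: mulD_ge0; [|rewrite FW// k0].
  have h2 : 0 <= p k.+1 * (v AtWorking k.+1 - v AtFailed k.+1).
    by apply: p_mul => k1m; exact: FW.
  have h3 : 0 <= mu * (v AtFailed k - v AtWorking k.-1).
    by rewrite mulD_ge0// -{2}(prednK k0) WF// (leq_ltn_trans (leq_pred _)).
  rewrite /best_site_value (gtn_eqF k0); rewrite (pS _ km) in h1 *.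
  by generalize (k%:R : R) => kR; lra.
- have h1 : 0 <= (1 - p k - tau) * (v AtStage k - v AtFailed k).
    by apply: mulD_ge0; [|rewrite FS// k0].
  have h2 : 0 <= p k * (v AtStage k.+1 - v AtFailed k.+1).
    by apply: p_mul => km'; exact: FS.
  have h3 : 0 <= mu * (v AtFailed k - v AtWorking k.-1).
    by rewrite mulD_ge0// -{2}(prednK k0) WF// prednK.
  by rewrite /best_site_value (gtn_eqF k0); generalize (k%:R : R) => kR; lra.
- have h1 : 0 <= (1 - p k - tau) * (v AtStage k - v AtWorking k).
    by apply: mulD_ge0; [|rewrite WS].
  have h2 : 0 <= lam * (v AtStage k.+1 - v AtFailed k.+1) by rewrite mulD_ge0// FS.
  have h3 : 0 <= p k.+1 * (v AtStage k.+1 - v AtWorking k.+1).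
    by apply: p_mul => k1m; exact: WS.
  rewrite (pS _ km) in h1 *.
  by generalize (k%:R : R) => kR; lra.
Qed.

End ClassValue.

(** * Optimality equations of the repair problem *)

Section Optimality.
Variables (R : realType) (G : repair_mdp R).

Local Notation V := (node G).
Local Notation machine := 'I_(nmach G).

Hypotheses (complete : forall u v : node G, u != v -> adj u v)
  (two_states : forall j : 'I_(nmach G), kmax j = 1%N).

Implicit Types x y : state G.

Definition failed x : {set machine} := [set j | x.2 j != 0%N :> nat]%SET.

Definition site_of x : site :=
  if [pick j | loc j == x.1] is Some j
  then if j \in failed x then AtFailed else AtWorking else AtStage.

Variant site_spec x : site -> Type :=
  | SiteFailed j of x.1 = loc j & j \in failed x : site_spec x AtFailed
  | SiteWorking j of x.1 = loc j & j \notin failed x : site_spec x AtWorking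
  | SiteStage of (forall j, x.1 != loc j) : site_spec x AtStage.

Lemma siteP x : site_spec x (site_of x).
Proof.
rewrite /site_of; case: pickP => [j /eqP jx|no].
  by case: ifPn => jf; [apply: (@SiteFailed x j)|apply: (@SiteWorking x j)].
by apply: SiteStage => j; rewrite eq_sym no.
Qed.

Lemma site_of_machine x j : x.1 = loc j ->
  site_of x = if j \in failed x then AtFailed else AtWorking.
Proof.
move=> xj; rewrite /site_of; case: pickP => [l /eqP|/(_ j)]; last by rewrite xj eqxx.
by rewrite xj => /loc_inj ->.
Qed.

Lemma in_failed x j : (j \in failed x) = (x.2 j != 0%N :> nat).
Proof. by rewrite inE. Qed.

Lemma failed_break x j : failed (set_condition x j 1) = (j |: failed x)%SET.
Proof.
apply/setP => l; rewrite !inE; case: (eqVneq l j) => [->|lj].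
  by rewrite set_condition_same// two_states.
by rewrite set_condition_other.
Qed.

Lemma failed_fix x j : failed (set_condition x j 0) = (failed x :\ j)%SET.
Proof.
apply/setP => l; rewrite !inE; case: (eqVneq l j) => [->|lj].
  by rewrite set_condition_same// eqxx.
by rewrite set_condition_other.
Qed.

Lemma card_failed_le x : (#|failed x| <= nmach G)%N.
Proof. by rewrite -[leqRHS]card_ord max_card. Qed.

Lemma card_working x : #|~: failed x| = (nmach G - #|failed x|)%N.
Proof. by rewrite cardsCs finset.setCK card_ord. Qed.

Lemma card_failed_lt x j : j \notin failed x -> (#|failed x| < nmach G)%N.
Proof.
move=> jf; rewrite -subn_gt0 -card_working (cardD1 j).
by rewrite !inE -in_failed jf.
Qed.

Lemma card_failed_gt0 x j : j \in failed x -> (0 < #|failed x|)%N.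
Proof. by move=> jf; rewrite (cardD1 j) jf. Qed.

(** The part of the expected gain that depends on the action. *)
Definition control_gain (F : state G -> R) (a : V) x : R :=
  \sum_(j | [&& loc j == x.1, a == x.1 & (0 < x.2 j)%N])
      mu j * (F (set_condition x j (x.2 j).-1) - F x)
  + (if adj x.1 a then tau G * (F (a, x.2) - F x) else 0).

Lemma control_gain_move F (a : V) x : a != x.1 ->
  control_gain F a x = tau G * (F (a, x.2) - F x).
Proof.
move=> ax; rewrite /control_gain big_pred0 => [|j].
  by rewrite add0r complete// eq_sym.
by rewrite (negbTE ax) andbF.
Qed.

Lemma control_gain_repair F x j : x.1 = loc j -> j \in failed x ->
  control_gain F x.1 x = mu j * (F (set_condition x j 0) - F x).
Proof.
move=> xj; rewrite in_failed => xf; rewrite /control_gain adj_irr addr0.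
rewrite (big_pred1 j) => [|l]; first by rewrite (state1 two_states xf).
rewrite eqxx/= xj (inj_eq (@loc_inj _ _)).
by case: eqVneq => //= ->; rewrite lt0n xf.
Qed.

Lemma control_gain_idle F x : (forall j, x.1 = loc j -> j \notin failed x) ->
  control_gain F x.1 x = 0.
Proof.
move=> noj; rewrite /control_gain adj_irr addr0 big_pred0// => j.
rewrite eqxx/=; case: eqP => //= /esym /noj.
by rewrite in_failed lt0n => /negbTE.
Qed.

Lemma sum_trans_gain (F : state G -> R) a x :
  \sum_y trans a x y * F y =
  F x + \sum_(j in ~: failed x) lam j * (F (set_condition x j 1) - F x)
  + control_gain F a x.
Proof.
rewrite sum_trans_mul (sum_rate_to a x (fun y => F y - F x)) -!addrA.
congr (_ + (_ + _)).
have ltK j : (x.2 j < kmax j)%N = (x.2 j == 0%N :> nat).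
  by rewrite [X in (_ < X)%N]two_states ltnS leqn0.
apply: eq_big => [j|j]; first by rewrite ltK !inE negbK.
by rewrite ltK => /eqP ->.
Qed.

(** The machines being identical, j0 stands for any of them. *)
Variable j0 : machine.
Hypotheses
  (same_lam : forall j l : 'I_(nmach G), lam j = lam l)
  (same_mu : forall j l : 'I_(nmach G), mu j = mu l)
  (same_f : forall j l : 'I_(nmach G), fcost j 1%N = fcost l 1%N).

Definition symmetric_value : nat -> site -> nat -> R :=
  class_value (nmach G) (lam j0) (mu j0) (tau G) (fcost j0 1).

Definition index_value t x : R := symmetric_value t (site_of x) #|failed x|.

Lemma cost_failed x : cost x = fcost j0 1 * #|failed x|%:R.
Proof.
rewrite /cost mulr_natr -sumr_const big_mkcond [RHS]big_mkcond/=.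
apply: eq_bigr => j _; rewrite in_failed; case: eqVneq => [->|xj] /=.
  exact: fcost0.
by rewrite (state1 two_states xj).
Qed.

Lemma symmetric_value_ordered t : ordered_classes (nmach G) (symmetric_value t).
Proof.
have lamE : (nmach G)%:R * lam j0 = \sum_(j : machine) lam j.
  rewrite mulr_natl -[X in _ *+ X]card_ord -sumr_const.
  by apply: eq_bigr => j _; exact: same_lam.
apply: class_value_ordered; rewrite ?lamE -?[leRHS](uniformized G) ?lerD2l.
- exact/ltW/lam_gt0.
- exact/ltW/mu_gt0.
- exact/ltW/tau_gt0.
- exact/ltW/fcost1_gt0.
- exact: (le_bigmax _ _ j0).
- exact: bigmax_ge_id.
Qed.

(** A destination of type AtFailed exists only if k > 0, and one of type
AtWorking only if k < m, so the order of the classes applies to every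
destination. *)
Lemma best_site_value_le t x :
  best_site_value (symmetric_value t) #|failed x| <= index_value t x.
Proof.
have [_ FW FS WS] := symmetric_value_ordered t.
have m0 : (0 < nmach G)%N by exact: ltn_trans (nmach_ge2 G).
rewrite /index_value /best_site_value; case: siteP => [j _ jf|j _ jf|_].
- by rewrite gtn_eqF// (card_failed_gt0 jf).
- case: posnP => [->//|k0]; rewrite FW// k0; exact: card_failed_lt jf.
- case: posnP => [->|k0]; first exact: WS.
  by rewrite FS// k0 card_failed_le.
Qed.

(** The control gain of the index policy, which is the least control gain. *)
Definition optimal_gain t x : R :=
  if site_of x is AtFailed
  then mu j0 * (symmetric_value t AtWorking #|failed x|.-1 - index_value t x)
  else tau G *
    (best_site_value (symmetric_value t) #|failed x| - index_value t x).

Lemma optimal_gain_le0 t x : optimal_gain t x <= 0.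
Proof.
have [WF _ _ _] := symmetric_value_ordered t.
rewrite /optimal_gain; have best := best_site_value_le t x.
have bad : tau G *
    (best_site_value (symmetric_value t) #|failed x| - index_value t x) <= 0.
  by rewrite mulr_ge0_le0 ?subr_le0// ltW// tau_gt0.
rewrite /index_value in bad *; case: siteP bad => // j _ jf _.
rewrite mulr_ge0_le0 ?(ltW (mu_gt0 _))// subr_le0.
have k0 := card_failed_gt0 jf.
by rewrite -{2}(prednK k0) WF// prednK// card_failed_le.
Qed.

Lemma index_value_machine t x j : x.1 = loc j ->
  index_value t x =
  symmetric_value t (if j \in failed x then AtFailed else AtWorking) #|failed x|.
Proof. by move=> xj; rewrite /index_value (site_of_machine xj). Qed.

Lemma repair_gain t x j : x.1 = loc j -> j \in failed x ->
  control_gain (index_value t) x.1 x = optimal_gain t x.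
Proof.
move=> xj jf; rewrite (control_gain_repair _ xj jf) /optimal_gain.
rewrite (site_of_machine xj) jf (same_mu j j0); congr (_ * (_ - _)).
rewrite (@index_value_machine _ (set_condition x j 0) j)// failed_fix.
by rewrite !inE eqxx/= (cardsD1 j (failed x)) jf.
Qed.

(** At a failed machine a repair has a gain <= 0 while the site cannot be
improved by any move; elsewhere the best site is also the best move. *)
Lemma optimal_gain_le t a x :
  optimal_gain t x <= control_gain (index_value t) a x.
Proof.
have [->|ax] := eqVneq a x.1.
  case: (siteP x) => [j xj jf|j xj jf|noj].
  - by rewrite (repair_gain _ xj jf).
  - rewrite control_gain_idle ?optimal_gain_le0// => l.
    by rewrite xj => /loc_inj <-.
  - rewrite control_gain_idle ?optimal_gain_le0// => l xl.
    by have := noj l; rewrite xl eqxx.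
rewrite control_gain_move//.
have bestle := best_site_value_le t (a, x.2).
case Es : (site_of x).
- apply: le_trans (optimal_gain_le0 t x) _.
  rewrite mulr_ge0 ?(ltW (tau_gt0 _))// subr_ge0; apply: le_trans bestle.
  rewrite /index_value Es /best_site_value.
  by move: Es; case: siteP => // j _ jf _; rewrite gtn_eqF// (card_failed_gt0 jf).
- by rewrite /optimal_gain Es ler_pM2l ?tau_gt0// lerD2r.
- by rewrite /optimal_gain Es ler_pM2l ?tau_gt0// lerD2r.
Qed.

(** Failures change the site only when the machine where the repairer is
fails, so all other failures contribute equal terms. *)
Lemma index_valueS t x :
  index_value t.+1 x = cost x + (index_value t x
  + \sum_(j in ~: failed x)
      lam j * (index_value t (set_condition x j 1) - index_value t x)
  + optimal_gain t x).
Proof.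
rewrite cost_failed {1}/index_value.
have cardU j : j \in (~: failed x)%SET -> #|j |: failed x| = #|failed x|.+1.
  by rewrite inE cardsU1 => ->.
have elsewhere j : j \in (~: failed x)%SET -> x.1 != loc j ->
    index_value t (set_condition x j 1) =
    symmetric_value t (site_of x) #|failed x|.+1.
  move=> jw xj; rewrite /index_value failed_break cardU//; congr symmetric_value.
  rewrite /site_of /=; case: pickP => // l /eqP lx.
  rewrite failed_break in_setU1; case: eqP => // lj.
  by move: xj; rewrite -lx lj eqxx.
have sum_elsewhere (A : {set machine}) n : #|A| = n ->
    (forall j, j \in A -> j \in (~: failed x)%SET /\ x.1 != loc j) ->
    \sum_(j in A)
      lam j * (index_value t (set_condition x j 1) - index_value t x)
    = n%:R * lam j0 *
      (symmetric_value t (site_of x) #|failed x|.+1 - index_value t x).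
  move=> <- AP; rewrite -mulrA mulr_natl -sumr_const; apply: eq_bigr => j /AP[jw xj].
  by rewrite elsewhere// (same_lam j j0).
have valx : index_value t x = symmetric_value t (site_of x) #|failed x| by [].
rewrite /optimal_gain; case: (siteP x) valx sum_elsewhere
  => [j xj jf|j xj jf|noj] valx sum_elsewhere /=.
- rewrite (sum_elsewhere _ _ (card_working x)) => [|l lw].
    by rewrite valx; ring.
  split=> //; rewrite xj; apply: contraTneq lw => /loc_inj <-.
  by rewrite inE jf.
- rewrite (big_setD1 j)/=; last by rewrite inE.
  rewrite (sum_elsewhere _ (nmach G - #|failed x|.+1)%N) => [||l].
  + rewrite (@index_value_machine _ (set_condition x j 1) j)// failed_break.
    rewrite setU11 cardU ?finset.in_setC// (same_lam j j0) valx; ring.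
  + have := card_working x; rewrite (cardsD1 j) !inE -in_failed jf subnS => <-.
    by [].
  + rewrite !inE => /andP[lj lw]; split=> //.
    by rewrite xj; apply: contraNneq lj => /loc_inj ->.
- rewrite (sum_elsewhere _ _ (card_working x)) => [|l lw]; last by split.
  by rewrite valx; ring.
Qed.

Lemma index_value_bellman t x a :
  index_value t.+1 x <= cost x + \sum_y trans a x y * index_value t y.
Proof. by rewrite index_valueS sum_trans_gain !lerD2l optimal_gain_le. Qed.

End Optimality.

(** * Optimality of the index policy *)

Section IndexOptimal.
Variables (R : realType) (G : repair_mdp R).
Variables (d : measure_display) (Omega : measurableType d) (P : probability Omega R).
Variable X : forall j : 'I_(nmach G), nat -> R -> Omega -> 'I_(kmax j).+1.
Variables (prio : seq (node G)) (prioP : perm_eq prio (enum (node G))).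
Hypotheses
  (XP : forall (j : 'I_(nmach G)) (k : 'I_(kmax j).+1),
     is_ctmc P (@repair_rate R G j) k (X j k))
  (complete : forall u v : node G, u != v -> adj u v)
  (two_states : forall j : 'I_(nmach G), kmax j = 1%N)
  (same_lam : forall j l : 'I_(nmach G), lam j = lam l)
  (same_mu : forall j l : 'I_(nmach G), mu j = mu l)
  (same_f : forall j l : 'I_(nmach G), fcost j 1%N = fcost l 1%N).
Variable j0 : 'I_(nmach G).

(** The choice left open by ties is harmless: all failed machines are equally
good destinations, and so are all machines when none has failed. *)
Lemma index_action_gain t (x : state G) :
  control_gain (index_value j0 t) (index_action P X prio x) x =
  optimal_gain j0 t x.
Proof.
have [[j [xj jf]]|nofail] :=
    pselect (exists j, x.1 = loc j /\ j \in failed x).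
  rewrite (index_action_stay prioP XP complete two_states same_lam same_mu
    same_f xj) -?in_failed//.
  exact: repair_gain xj jf.
have xwork j : x.1 = loc j -> j \notin failed x.
  by move=> xj; apply/negP => jf; apply: nofail; exists j.
have gainE : optimal_gain j0 t x =
    tau G *
    (best_site_value (symmetric_value j0 t) #|failed x| - index_value j0 t x).
  rewrite /optimal_gain; case: (siteP x) => // j xj jf.
  by move: (xwork j xj); rewrite jf.
have [x0|[l lf]] := set_0Vmem (failed x).
  have x0' j : x.2 j = 0%N :> nat.
    by apply/eqP/negPn; rewrite -in_failed x0 inE.
  have [j actE] := index_action_idle P X prioP complete x0'.
  rewrite actE gainE.
  have bestE : best_site_value (symmetric_value j0 t) #|failed x| =
      index_value j0 t (loc j, x.2).
    rewrite (@index_value_machine _ _ _ _ (loc j, x.2) j)// /failed/=.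
    by rewrite -/(failed x) x0 inE cards0.
  have [jx|jx] := eqVneq (loc j) x.1; last by rewrite control_gain_move// bestE.
  have xE : (loc j, x.2) = x by rewrite jx; case: (x).
  by rewrite jx control_gain_idle// bestE xE subrr mulr0.
have lf' := lf; rewrite in_failed in lf'.
have xwork' j : x.1 = loc j -> x.2 j = 0%N :> nat.
  by move=> /xwork; rewrite in_failed negbK => /eqP.
have [j jf ->] :=
  index_action_travel prioP XP complete two_states same_lam same_mu same_f
    lf' xwork'.
rewrite gainE control_gain_move//; last first.
  by apply: contraNneq jf => /esym /xwork' ->.
rewrite (@index_value_machine _ _ _ _ (loc j, x.2) j)//.
by rewrite in_failed jf /best_site_value gtn_eqF// (card_failed_gt0 lf).
Qed.

Lemma index_cost_to_go h t (x : state G) :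
  cost_to_go (index_policy P X prio) h x t = index_value j0 t x.
Proof.
apply: cost_to_go_stationary => // {}t {}x.
by rewrite index_valueS// sum_trans_gain// index_action_gain.
Qed.

End IndexOptimal.

Theorem proposition4p5 (R : realType) (G : repair_mdp R)
  (prio : seq (node G)) (prioP : perm_eq prio (enum (node G)))
  (d : measure_display) (Omega : measurableType d) (P : probability Omega R)
  (X : forall j : 'I_(nmach G), nat -> R -> Omega -> 'I_(kmax j).+1)
  (XP : forall (j : 'I_(nmach G)) (k : 'I_(kmax j).+1),
     is_ctmc P (@repair_rate R G j) k (X j k))
  (complete : forall u v : node G, u != v -> adj u v)
  (two_states : forall j : 'I_(nmach G), kmax j = 1%N)
  (same_lam : forall j l : 'I_(nmach G), lam j = lam l)
  (same_mu : forall j l : 'I_(nmach G), mu j = mu l)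
  (same_f : forall j l : 'I_(nmach G), fcost j 1%N = fcost l 1%N) :
  forall (theta : policy G) (x : state G),
    (avg_cost (index_policy P X prio) x <= avg_cost theta x)%E.
Proof.
move=> theta x.
pose j0 : 'I_(nmach G) := Ordinal (ltn_trans (ltn0Sn 0) (nmach_ge2 G)).
apply: le_avg_cost => t.
rewrite -[leLHS]/(cost_to_go _ [::] x t) -[leRHS]/(cost_to_go _ [::] x t).
rewrite (index_cost_to_go prioP XP complete two_states same_lam same_mu same_f j0).
apply: cost_to_go_ge => // {}t {}x a _.
exact: index_value_bellman.
Qed.
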